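(* Let $E$ be a finite set and let $\lambda:2^E\to\mathbb{R}$ be a connectivity function on $E$. Then there exists a compact, self-dual polymatroid $P=(r,E)$ whose connectivity function $\lambda_P$ equals $\lambda$.
   Context: A connectivity function on a finite set $E$ is a function $\lambda:2^E\to\mathbb{R}$ with $\lambda(\emptyset)=0$, $\lambda(X)=\lambda(E-X)$ for all $X\subseteq E$, and $\lambda(X\cap Y)+\lambda(X\cup Y)\le\lambda(X)+\lambda(Y)$ for all $X,Y\subseteq E$. A polymatroid $P=(r,E)$ is a finite set $E$ with a function $r:2^E\to\mathbb{R}$ such that $r(\emptyset)=0$, $r(X\cap Y)+r(X\cup Y)\le r(X)+r(Y)$ for all $X,Y\subseteq E$, and $r(X)\le r(Y)$ whenever $X\subseteq Y\subseteq E$. Its connectivity function is $\lambda_P(X)=r(X)+r(E-X)-r(E)$. For $X\subseteq E$ let $\|X\|_r=\sum_{x\in X}r(\{x\})$. The dual of $P$ is $P^*=(r^*,E)$ where $r^*(X)=r(E-X)+\|X\|_r-r(E)$ for all $X\subseteq E$; $P$ is self-dual if $r^*=r$. An element $e\in E$ is compact if $r(\{e\})=\lambda_P(\{e\})$, and $P$ is compact if every element of $E$ is compact. *)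

(* Defs.v *)
From mathcomp Require Import all_boot all_order all_algebra.
From mathcomp Require Import reals.

Set Implicit Arguments.
Unset Strict Implicit.
Unset Printing Implicit Defensive.

Import Order.TTheory GRing.Theory Num.Theory.
Local Open Scope ring_scope.

(* The ground set is the finite type E, so the complement E - X is ~: X and   *)
(* E itself is [set: E].                                                      *)

Definition submodular (R : realType) (E : finType) (f : {set E} -> R) : Prop :=
  forall X Y : {set E}, f (X :&: Y) + f (X :|: Y) <= f X + f Y.

Definition connectivity_function (R : realType) (E : finType)
    (lambda : {set E} -> R) : Prop :=
  [/\ lambda set0 = 0,
      forall X : {set E}, lambda X = lambda (~: X)
    & submodular lambda].

Record polymatroid (R : realType) (E : finType) := Polymatroid {
  rank :> {set E} -> R;
  rank0 : rank set0 = 0;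
  rank_submodular : submodular rank;
  rank_monotone : forall X Y : {set E}, X \subset Y -> rank X <= rank Y
}.

Definition connectivity (R : realType) (E : finType) (P : polymatroid R E)
    (X : {set E}) : R :=
  P X + P (~: X) - P [set: E].

Definition rank_norm (R : realType) (E : finType) (P : polymatroid R E)
    (X : {set E}) : R :=
  \sum_(x in X) P [set x].

Definition dual_rank (R : realType) (E : finType) (P : polymatroid R E)
    (X : {set E}) : R :=
  P (~: X) + rank_norm P X - P [set: E].

Definition self_dual (R : realType) (E : finType) (P : polymatroid R E) : Prop :=
  dual_rank P =1 P.

Definition compact_element (R : realType) (E : finType) (P : polymatroid R E)
    (e : E) : Prop :=
  P [set e] = connectivity P [set e].

Definition compact (R : realType) (E : finType) (P : polymatroid R E) : Prop :=
  forall e : E, compact_element P e.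

(* Main.v *)
(* The polymatroid is r(X) = (lambda(X) + sum_(x in X) lambda({x})) / 2.  The
   modular term cancels in every identity to be checked, and monotonicity comes
   from lambda(X) <= lambda(Y) + lambda(Y - X) for X inside Y, which is
   submodularity applied to Y and E - (Y - X), together with the subadditivity
   lambda(Y - X) <= sum_(x in Y - X) lambda({x}). *)
Require Import Defs.
From mathcomp Require Import all_boot all_order all_algebra.
From mathcomp Require Import reals.
From mathcomp Require Import lra.

Import Order.TTheory GRing.Theory Num.Theory.
Local Open Scope ring_scope.

Definition singleton_sum {R : realType} {E : finType} (f : {set E} -> R)
    (X : {set E}) : R :=
  \sum_(x in X) f [set x].

Lemma singleton_sum_modular {R : realType} {E : finType} (f : {set E} -> R)
    (X Y : {set E}) :
  singleton_sum f (X :&: Y) + singleton_sum f (X :|: Y) =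
  singleton_sum f X + singleton_sum f Y.
Proof.
rewrite /singleton_sum (big_setID X (A := X :|: Y)) (big_setID X (A := Y)) /=.
by rewrite setUK setDUl setDv set0U [Y :&: X]setIC addrCA.
Qed.

Lemma singleton_sumC {R : realType} {E : finType} (f : {set E} -> R)
    (X : {set E}) :
  singleton_sum f (~: X) = singleton_sum f [set: E] - singleton_sum f X.
Proof.
rewrite /singleton_sum (big_setID X (A := [set: E])) /= setTI setTD.
by rewrite addrAC subrr add0r.
Qed.

(** Induction on [#|X|], splitting off one point [x]: since [[set x]] and [X :\ x] are disjoint, the
    intersection term of submodularity is [f set0 = 0]. *)
Lemma submodular_le_singleton_sum {R : realType} {E : finType}
    (f : {set E} -> R) (X : {set E}) :
  f set0 = 0 -> submodular f -> f X <= singleton_sum f X.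
Proof.
move=> f0 fsub; have [n] := ubnP #|X|; elim: n X => // n IHn X.
have [->|[x xX]] := set_0Vmem X; first by rewrite /singleton_sum big_set0 f0.
rewrite (cardsD1 x) xX ltnS => /IHn le_Xx.
have := fsub [set x] (X :\ x).
rewrite setD1K // [_ :&: _]disjoint_setI0 ?disjoints1 ?setD11 // f0 add0r => le_X.
by rewrite /singleton_sum (big_setD1 x) //= (le_trans le_X) // lerD2l.
Qed.

Lemma connectivity_le_diff {R : realType} {E : finType}
    {lambda : {set E} -> R} {X Y : {set E}} :
  connectivity_function lambda -> X \subset Y ->
  lambda X <= lambda Y + lambda (Y :\: X).
Proof.
case=> l0 lC lsub sXY; have := lsub Y (~: (Y :\: X)).
(* The two sets meet in [X] and together cover the ground set, where [lambda] vanishes by symmetry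
   with [set0]. *)
rewrite -lC -setDE setDDr setDv set0U (setIidPr sXY).
by rewrite setCD setUA setUCr setTU [lambda setT]lC setCT l0 addr0.
Qed.

Theorem theorem4p4 (R : realType) (E : finType) (lambda : {set E} -> R)
    (hlambda : connectivity_function lambda) :
  exists P : polymatroid R E,
    [/\ compact P, self_dual P & connectivity P =1 lambda].
Proof.
have [l0 lC lsub] := hlambda.
have lT : lambda [set: E] = 0 by rewrite lC setCT.
pose r X := (lambda X + singleton_sum lambda X) / 2.
have r0 : r set0 = 0 by rewrite /r l0 /singleton_sum big_set0 addr0 mul0r.
have rsub : submodular r.
  move=> X Y; rewrite /r.
  have := lsub X Y; have := singleton_sum_modular lambda X Y; lra.
have rmono (X Y : {set E}) : X \subset Y -> r X <= r Y.
  move=> sXY; rewrite /r.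
  have := connectivity_le_diff hlambda sXY.
  have := submodular_le_singleton_sum lambda (Y :\: X) l0 lsub.
  have : singleton_sum lambda Y
      = singleton_sum lambda X + singleton_sum lambda (Y :\: X).
    by rewrite /singleton_sum (big_setID X) /= (setIidPr sXY).
  lra.
(* Both summands of [r] are [lambda [set e]] here, so halving makes [r] and [lambda] agree on
   singletons; compactness and the norm in the dual rest on this. *)
have r1 e : r [set e] = lambda [set e].
  by rewrite /r /singleton_sum big_set1; lra.
pose P := Polymatroid r0 rsub rmono.
(* By symmetry [lambda X] appears in two halves; the singleton sums over [X] and [~: X] cancel
   against the one over the whole set. *)
have connP : connectivity P =1 lambda.
  move=> X; rewrite /connectivity /= /r singleton_sumC -lC lT; lra.
exists P; split=> // [e|X]; first by rewrite /compact_element connP /= r1.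
have -> : dual_rank P X = r (~: X) + singleton_sum lambda X - r [set: E].
  by rewrite /dual_rank /rank_norm (eq_bigr _ (fun e _ => r1 e)).
(* With s the singleton sum, s(E - X)/2 + s(X) - s(E)/2 = s(X)/2, the modular part of [r X]. *)
rewrite /= /r singleton_sumC -lC lT; lra.
Qed.
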